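(* Let $1\le c\le n-1$ and $\gamma<0$. For every connected graph $G$ of order $n$ with edge connectivity $1\le\kappa'(G)\le c$, \[{}^0R_{\gamma}(G)\le (n-1)+(n-1)^{\gamma},\] with equality if and only if $G=S_n$.
   Context: ${}^0R_{\gamma}(G)=\sum_{u\in V(G)} d(u)^{\gamma}$. Graphs are finite and simple. $\kappa'(G)$ is edge connectivity. $S_n$ is the star on $n$ vertices. *)

(* Defs.v *)
From HB Require Import structures.
From mathcomp Require Import all_boot all_order all_algebra.
From mathcomp Require Import reals exp.

Set Implicit Arguments.
Unset Strict Implicit.
Unset Printing Implicit Defensive.

Import Order.TTheory GRing.Theory Num.Theory.
Local Open Scope ring_scope.

Record sgraph := SGraph {
  vertex :> finType;
  adj : rel vertex;
  adj_sym : symmetric adj;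
  adj_irrefl : irreflexive adj }.

Definition graph_order (G : sgraph) : nat := #|G|.

Definition degree (G : sgraph) (u : G) : nat := #|[set v : G | adj u v]|.

Definition edges (G : sgraph) : {set {set G}} :=
  [set [set p.1; p.2] | p : G * G & adj p.1 p.2].

Definition graph_connected (G : sgraph) : bool :=
  (0 < graph_order G)%N && [forall x : G, forall y : G, connect (@adj G) x y].

Section DelEdges.
Variables (G : sgraph) (F : {set {set G}}).

Definition del_adj : rel G := [rel x y | adj x y && ([set x; y] \notin F)].

Lemma del_adj_sym : symmetric del_adj.
Proof. by move=> x y; rewrite /del_adj /= adj_sym setUC. Qed.

Lemma del_adj_irrefl : irreflexive del_adj.
Proof. by move=> x; rewrite /del_adj /= adj_irrefl. Qed.

Definition del_edges : sgraph := SGraph del_adj_sym del_adj_irrefl.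
End DelEdges.

(* The default value #|edges G| only matters for the one-vertex graph, which
   no edge deletion disconnects; it then gives the usual convention 0. On at
   least two vertices, F := edges G is itself among the competitors. *)
Definition edge_connectivity (G : sgraph) : nat :=
  \big[minn/#|edges G|]_(F : {set {set G}} |
    (F \subset edges G) && ~~ graph_connected (del_edges F)) #|F|.

Section Star.
Variable n : nat.

Definition star_adj : rel 'I_n :=
  [rel i j | (i != j) && ((val i == 0%N) || (val j == 0%N))].

Lemma star_adj_sym : symmetric star_adj.
Proof. by move=> i j; rewrite /star_adj /= eq_sym orbC. Qed.

Lemma star_adj_irrefl : irreflexive star_adj.
Proof. by move=> i; rewrite /star_adj /= eqxx. Qed.

Definition star : sgraph := SGraph star_adj_sym star_adj_irrefl.
End Star.

Definition isomorphic (G H : sgraph) : Prop :=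
  exists2 f : G -> H, bijective f & forall x y : G, adj (f x) (f y) = adj x y.

(* Isolated vertices contribute 0 when gamma < 0, by the library convention
   for 0 `^ gamma; they do not occur in connected graphs of order >= 2. *)
Definition zeroth_randic (R : realType) (gamma : R) (G : sgraph) : R :=
  \sum_(u : G) (degree u)%:R `^ gamma.

(* Main.v *)
Require Import Defs.
From HB Require Import structures.
From mathcomp Require Import all_boot all_order all_algebra.
From mathcomp Require Import reals exp.
From mathcomp Require Import perm sequences ring zify.

Set Implicit Arguments.
Unset Strict Implicit.
Unset Printing Implicit Defensive.

Import Order.TTheory GRing.Theory Num.Theory.
Local Open Scope ring_scope.

(** For [gamma < 0] the map [d |-> d `^ gamma] is strictly convex, hence on
    [1, n-1] it lies below the chord through the points [1] and [n-1], strictly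
    so in the interior.  Summing the chord bound over the vertices and using
    that a connected graph has degree sum at least [2(n-1)], as the chord has
    negative slope, gives the bound.  In the case of equality every degree is
    [1] or [n-1] and the degree sum is [2(n-1)], which forces a star. *)

(** * Strict chord inequalities for exponentials and powers *)

(** The graph of [expR] lies strictly above its tangent at [s * y]. Comparing at [0] and at [y] with
    weights [1 - s] and [s] cancels the linear terms. *)
Lemma expR_chord_lt (R : realType) (s y : R) :
  0 < s < 1 -> y != 0 -> expR (s * y) < (1 - s) + s * expR y.
Proof.
move=> /andP[s0 s1] y0.
have h1 : 1 + - (s * y) < expR (- (s * y)).
  by apply: expR_gt1Dx; rewrite oppr_eq0 mulf_neq0 ?(gt_eqF s0).
have h2 : 1 + (1 - s) * y < expR ((1 - s) * y).
  by apply: expR_gt1Dx; rewrite mulf_neq0 // gt_eqF // subr_gt0.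
have e0 := expR_gt0 (s * y).
have e1 : expR (s * y) * expR (- (s * y)) = 1 by rewrite -expRD subrr expR0.
have e2 : expR (s * y) * expR ((1 - s) * y) = expR y.
  by rewrite -expRD; congr expR; ring.
rewrite -subr_gt0.
have -> : 1 - s + s * expR y - expR (s * y) =
    expR (s * y) * ((1 - s) * (expR (- (s * y)) - (1 + - (s * y)))
                    + s * (expR ((1 - s) * y) - (1 + (1 - s) * y))).
  by rewrite -e2; ring: e1.
by rewrite mulr_gt0 // addr_gt0 // mulr_gt0 // subr_gt0.
Qed.

(** Write [d = (1 - s) * 1 + s * m]. The chord bound for [expR] is used twice: between [0] and
    [ln m] it gives concavity of [ln], and between [0] and [gamma * ln m] it gives the chord of the
    power function. *)
Lemma powR_chord_lt (R : realType) (gamma m d : R) : gamma < 0 -> 1 < d < m ->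
  d `^ gamma < 1 - (d - 1) * ((1 - m `^ gamma) / (m - 1)).
Proof.
move=> g0 /andP[d1 dm].
have m1 : 1 < m by apply: lt_trans dm.
have m1n : m - 1 != 0 by rewrite subr_eq0 gt_eqF.
pose s := (d - 1) / (m - 1).
have s01 : 0 < s < 1.
  by rewrite divr_gt0 ?subr_gt0 //= ltr_pdivrMr ?subr_gt0 // mul1r ltrD2r.
have lm : 0 < ln m by rewrite ln_gt0.
have sln : s * ln m < ln d.
  have /lt_le_trans : expR (s * ln m) < (1 - s) + s * expR (ln m).
    by apply: expR_chord_lt => //; rewrite gt_eqF.
  move=> /(_ d); rewrite lnK ?posrE ?(lt_trans ltr01) // => sd.
  rewrite -ltr_expR lnK ?posrE ?(lt_trans ltr01) //; apply: sd.
  by rewrite le_eqVlt; apply/orP; left; apply/eqP; rewrite /s; field.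
(* Multiplying by [gamma < 0] reverses [s * ln m < ln d]. *)
have gs : expR (gamma * ln d) < expR (s * (gamma * ln m)).
  by rewrite ltr_expR mulrCA ltr_nM2l.
rewrite /powR !gt_eqF ?(lt_trans ltr01) //.
apply: (lt_trans gs).
have := @expR_chord_lt R s (gamma * ln m) s01.
rewrite mulf_neq0 ?(lt_eqF g0) ?(gt_eqF lm) // => /(_ isT).
suff -> : 1 - (d - 1) * ((1 - expR (gamma * ln m)) / (m - 1))
          = 1 - s + s * expR (gamma * ln m) by [].
by rewrite /s; field.
Qed.

Lemma powR_chord_le (R : realType) (gamma m d : R) :
    gamma < 0 -> 1 < m -> 1 <= d <= m ->
  d `^ gamma <= 1 - (d - 1) * ((1 - m `^ gamma) / (m - 1)).
Proof.
move=> g0 m1; rewrite !le_eqVlt => /andP[].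
case/predU1P => [<- _|d1]; first by rewrite powR1 subrr mul0r subr0 eqxx.
case/predU1P => [->|dm]; last by rewrite powR_chord_lt ?orbT // d1.
apply/orP; left; apply/eqP.
by field; rewrite subr_eq0 gt_eqF.
Qed.

(** * Degree sums of connected graphs *)

Section Graph.
Variable G : sgraph.

(** Ordered pairs count each edge inside [S] twice, which matches the degree sum without passing
    through [edges]. *)
Definition adj_pairs (S : {set G}) : {set G * G} :=
  [set p | [&& p.1 \in S, p.2 \in S & adj p.1 p.2]].

Lemma sum_degree : (\sum_(u : G) degree u = #|adj_pairs setT|)%N.
Proof.
rewrite -sum1_card.
transitivity (\sum_(u : G) \sum_(v : G | adj u v) 1)%N.
  apply: eq_bigr => u _; rewrite /degree -sum1_card.
  by apply: eq_bigl => v; rewrite inE.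
rewrite pair_big_dep /=; apply: eq_bigl => p.
by rewrite !inE.
Qed.

(** If no edge left [S], then [S] would be closed under adjacency, hence under [connect], and could
    not separate [a] from [b]. *)
Lemma connected_boundary (S : {set G}) : graph_connected G ->
  S != set0 -> S != setT -> exists x y, [/\ x \in S, y \notin S & adj x y].
Proof.
move=> /andP[_ /forallP hconn] /set0Pn[a aS] ST.
have [b bS] : exists b, b \notin S.
  by apply/existsP; rewrite -negb_forall; apply: contra ST => /forallP h;
     apply/eqP/setP => x; rewrite inE h.
case: (boolP [exists x in S, [exists y, (y \notin S) && adj x y]]).
  by case/exists_inP => x xS /existsP[y /andP[yS xy]]; exists x, y.
move=> none; have clS : closed (@adj G) (mem S).
  apply: intro_closed; first exact: sym_connect_sym (@adj_sym G).
  move=> x y xy xS; apply: contraNT none => yS.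
  by apply/exists_inP; exists x => //; apply/existsP; exists y; rewrite yS.
have /forallP/(_ b) ab := hconn a.
by have := closed_connect clS ab; rewrite aS (negbTE bS).
Qed.

Lemma card_adj_pairs_setU1 (S : {set G}) (x y : G) :
    x \in S -> y \notin S -> adj x y ->
  (#|adj_pairs S| + 2 <= #|adj_pairs (y |: S)|)%N.
Proof.
move=> xS yS xy.
have xny : x != y by apply: contraNneq yS => <-.
have dis : [disjoint adj_pairs S & [set (x, y); (y, x)]].
  rewrite disjoint_sym disjoints_subset; apply/subsetP => p.
  by rewrite !inE => /orP[]/eqP-> /=; rewrite (negbTE yS) ?andbF.
have c2 : #|[set (x, y); (y, x)]| = 2%N.
  by rewrite cards2 xpair_eqE (negbTE xny).
rewrite -c2 -cardsUI (_ : _ :&: _ = set0) ?cards0 ?addn0; last exact/disjoint_setI0.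
apply/subset_leq_card/subsetP => p; rewrite !inE.
case/or3P => [/and3P[-> -> ->]|/eqP->|/eqP->] /=; rewrite ?orbT //.
  by rewrite xS eqxx xy orbT.
by rewrite xS eqxx adj_sym xy orbT.
Qed.

(** In place of a spanning tree, a vertex set is grown from a single point: each boundary edge
    brings in one vertex and two ordered pairs. *)
Lemma connected_sum_degree : graph_connected G ->
  (2 * (#|G| - 1) <= \sum_(u : G) degree u)%N.
Proof.
move=> hG; have /andP[G0 _] := hG.
have [a _] : exists a : G, a \in predT by apply/card_gt0P.
suff grow k : (k < #|G|)%N ->
    exists2 S : {set G}, #|S| = k.+1 & (2 * k <= #|adj_pairs S|)%N.
  have [|S cS leS] := grow (#|G| - 1)%N; first by rewrite /graph_order in G0; lia.
  rewrite sum_degree; apply: leq_trans leS _.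
  by apply/subset_leq_card/subsetP => p; rewrite !inE => /and3P[_ _ ->].
elim: k => [|k IHk] ltk; first by exists [set a]; rewrite ?cards1 ?muln0.
have [S cS leS] := IHk (ltnW ltk).
have [||x [y [xS yS xy]]] := connected_boundary (S := S) hG.
- by rewrite -card_gt0 cS.
- by apply: contraTneq ltk => ST; rewrite -cS ST cardsT ltnn.
exists (y |: S); first by rewrite cardsU1 yS cS.
by have := card_adj_pairs_setU1 xS yS xy; lia.
Qed.

Lemma degree_le (u : G) : (degree u <= #|G| - 1)%N.
Proof.
have <- : #|[set~ u]| = (#|G| - 1)%N by rewrite cardsC1 subn1.
apply/subset_leq_card/subsetP => v; rewrite !inE => uv.
by apply: contraTneq uv => ->; rewrite adj_irrefl.
Qed.

Lemma connected_degree_gt0 (u : G) : graph_connected G -> (1 < #|G|)%N ->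
  (0 < degree u)%N.
Proof.
move=> hG G1; have [||x [y []]] := connected_boundary (S := [set u]) hG.
- by rewrite -card_gt0 cards1.
- by apply: contraTneq G1 => uT; rewrite -cardsT -uT cards1.
by rewrite inE => /eqP-> _ uy; apply/card_gt0P; exists y; rewrite inE.
Qed.

(** * Stars and their degrees *)

(** An intrinsic form of being a star, free of the labelling by ordinals. *)
Definition star_center (u : G) :=
  forall x y : G, adj x y = (x != y) && ((x == u) || (y == u)).

Lemma isomorphic_starP : (0 < #|G|)%N ->
  isomorphic G (star #|G|) <-> exists u, star_center u.
Proof.
move=> G0; pose o := Ordinal G0.
have starE (i j : star #|G|) : adj i j = (i != j) && ((i == o) || (j == o)) by [].
split=> [[f [g fK gK] fadj]|[u cu]].
  exists (g o) => x y; rewrite -fadj starE.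
  by rewrite (can_eq fK) !(can2_eq fK gK).
(* The enumeration of [G], corrected by a transposition so that the centre gets label [0]. *)
pose f x := tperm (enum_rank u) o (enum_rank x).
have fu : f u = o by rewrite /f tpermL.
have finj : injective f by move=> x y /perm_inj/enum_rank_inj.
exists f => [|x y].
  by apply: inj_card_bij finj _; rewrite card_ord.
by rewrite cu starE -fu !(inj_eq finj).
Qed.

Lemma star_center_degree (u : G) : star_center u ->
  degree u = (#|G| - 1)%N /\ forall x, x != u -> degree x = 1%N.
Proof.
move=> cu; split=> [|x xu].
  rewrite subn1 -(cardsC1 u); apply: eq_card => v.
  by rewrite !inE cu eqxx andbT eq_sym.
rewrite -(cards1 u); apply: eq_card => v.
by rewrite !inE cu (negbTE xu) /=; have [->|] := eqVneq v u; rewrite ?andbT ?andbF.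
Qed.

(** The vertex [u] is adjacent to all others, so an edge [x y] avoiding [u] would give [x] the two
    neighbours [u] and [y]. *)
Lemma degree_star_center (u : G) : degree u = (#|G| - 1)%N ->
  (forall x, x != u -> degree x = 1%N) -> star_center u.
Proof.
move=> du d1.
have Nu : [set v | adj u v] = [set~ u].
  apply/eqP; rewrite eqEcard cardsC1 -subn1 -du leqnn andbT.
  apply/subsetP => v; rewrite !inE => uv.
  by apply: contraTneq uv => ->; rewrite adj_irrefl.
have adju v : adj u v = (v != u) by have /setP/(_ v) := Nu; rewrite !inE.
move=> x y; have [->|xu] := eqVneq x u; first by rewrite adju andbT eq_sym.
have [->|yu] /= := eqVneq y u; first by rewrite adj_sym adju xu.
rewrite andbF; apply/negP => xy.
have : (#|[set u; y]| <= degree x)%N.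
  apply/subset_leq_card/subsetP => v; rewrite !inE => /orP[]/eqP-> //.
  by rewrite adj_sym adju.
by rewrite d1 // cards2 eq_sym yu.
Qed.

Lemma zeroth_randic_star_center (R : realType) (gamma : R) (u : G) :
  star_center u -> (0 < #|G|)%N ->
  zeroth_randic gamma G = (#|G|%:R - 1) + (#|G|%:R - 1) `^ gamma.
Proof.
move=> cu G0; have [du d1] := star_center_degree cu.
rewrite /zeroth_randic (bigD1 u) //= du natrB // addrC; congr (_ + _).
under eq_bigr => x xu do rewrite d1 // powR1.
by rewrite sumr_const cardC1 -subn1 natrB.
Qed.

(* The degree sum [2(n-1)] leaves room for only one vertex of degree [n-1]. *)
Lemma extremal_degrees_star_center : graph_connected G -> (1 < #|G|)%N ->
    (forall u : G, degree u = 1%N \/ degree u = (#|G| - 1)%N) ->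
    (\sum_(u : G) degree u = 2 * (#|G| - 1))%N ->
  exists u, star_center u.
Proof.
move=> hG G1 d1m sumd.
have [u du] : exists u : G, degree u = (#|G| - 1)%N.
  have [/existsP[u /eqP du]|] := boolP [exists u : G, degree u == (#|G| - 1)%N].
    by exists u.
  rewrite negb_exists => /forallP none.
  have [a _] : exists a : G, a \in predT by apply/card_gt0P; apply: ltnW.
  exists a; have da : degree a = 1%N.
    by case: (d1m a) => // da; have := none a; rewrite da eqxx.
  (* If all degrees are [1], the degree sum is both [n] and [2(n-1)], so [n = 2] and [1 = n - 1]
     after all. *)
  move: sumd; rewrite (eq_bigr (fun=> 1%N)) => [|v _]; last first.
    by case: (d1m v) => // dv; have := none v; rewrite dv eqxx.
  by rewrite (_ : (\sum_(v : G) 1)%N = #|G|) ?sum1_card // da; lia.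
exists u; apply: degree_star_center => // x xu.
(* The [n - 2] vertices other than [u] and [x] have positive degree, so [degree x + S = n - 1]
   leaves at most [1] for [x]. *)
pose S := (\sum_(v | (v != u) && (v != x)) degree v)%N.
have sumx : (degree x + S = #|G| - 1)%N.
  by move: sumd; rewrite (bigD1 u) // (bigD1 x) //= du mul2n -addnn => /addnI.
have leS : (#|G| - 2 <= S)%N.
  have <- : #|[set~ u] :\ x| = (#|G| - 2)%N.
    by have := cardsD1 x [set~ u]; rewrite cardsC1 !inE xu; lia.
  rewrite -sum1_card /S; under eq_bigl => v do rewrite !inE andbC.
  by apply: leq_sum => v _; apply: connected_degree_gt0.
have := connected_degree_gt0 x hG G1; lia.
Qed.

(* The gap to the bound, split into the convexity defects of the degrees and
   the excess of the degree sum, with [h] the slope of the chord. *)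
Lemma randic_gap (R : realType) (gamma : R) : (2 < #|G|)%N ->
  let m := #|G|%:R - 1 in let h := (1 - m `^ gamma) / (m - 1) in
  m + m `^ gamma - zeroth_randic gamma G =
  \sum_(u : G) (1 - ((degree u)%:R - 1) * h - (degree u)%:R `^ gamma)
  + ((\sum_(u : G) degree u)%:R - 2 * m) * h.
Proof.
move=> G2 m h.
(* Order above [2] makes the denominator of the slope nonzero. *)
have m1 : m - 1 != 0.
  by rewrite /m subr_eq0 gt_eqF // ltrBrDr -[1 + 1]/(2%:R) ltr_nat.
rewrite sumrB -/(zeroth_randic gamma G) sumrB -mulr_suml sumrB natr_sum.
rewrite !sumr_const (_ : 1 *+ #|_| = m + 1); last by rewrite /m subrK.
have -> : m `^ gamma = 1 - h * (m - 1) by rewrite /h divfK // opprB addrC subrK.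
ring.
Qed.

End Graph.

(** * The bound and the case of equality *)

Lemma powR_lt1 (R : realType) (gamma m : R) : gamma < 0 -> 1 < m ->
  m `^ gamma < 1.
Proof.
move=> g0 m1; rewrite /powR gt_eqF ?(lt_trans ltr01) // -expR0 ltr_expR.
by rewrite nmulr_rlt0 // ln_gt0.
Qed.

Theorem theorem3p10 (R : realType) (n c : nat) (gamma : R) (G : sgraph)
    (hc : (1 <= c <= n - 1)%N) (hgamma : gamma < 0)
    (hn : graph_order G = n) (hG : graph_connected G)
    (hk : (1 <= edge_connectivity G <= c)%N) :
  zeroth_randic gamma G <= (n%:R - 1) + (n%:R - 1) `^ gamma /\
  (zeroth_randic gamma G = (n%:R - 1) + (n%:R - 1) `^ gamma <->
     isomorphic G (star n)).
Proof.
have G1 : (1 < #|G|)%N by rewrite /graph_order in hn; lia.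
rewrite -{n}hn /graph_order in hc *.
have G0 := ltnW G1.
have degP (u : G) : (1 <= degree u <= #|G| - 1)%N.
  by rewrite degree_le connected_degree_gt0.
have sumP := connected_sum_degree hG.
rewrite (isomorphic_starP G0).
suff [le_bound eq_star] :
    zeroth_randic gamma G <= (#|G|%:R - 1) + (#|G|%:R - 1) `^ gamma /\
    (zeroth_randic gamma G = (#|G|%:R - 1) + (#|G|%:R - 1) `^ gamma ->
       exists u : G, star_center u).
  split=> //; split=> // -[u cu].
  exact: zeroth_randic_star_center cu G0.
(* For order [2] the chord degenerates to a point, [m - 1 = 0]; the graph is then a single edge,
   which is a star. *)
have [G2|G2] := leqP #|G| 2.
  have eG : #|G| = 2%N by lia.
  have d1 (u : G) : degree u = 1%N by have := degP u; lia.
  have [u cu] : exists u : G, star_center u.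
    apply: extremal_degrees_star_center => // [v|]; first by left.
    by rewrite (eq_bigr (fun=> 1%N)) // sum1_card eG.
  by split; [rewrite (zeroth_randic_star_center gamma cu) | exists u].
set m : R := #|G|%:R - 1; set h := (1 - m `^ gamma) / (m - 1).
have m1 : 1 < m by rewrite /m ltrBrDr -[1 + 1]/(2%:R) ltr_nat.
have mE : m = (#|G| - 1)%:R by rewrite natrB.
have h0 : 0 < h by rewrite divr_gt0 ?subr_gt0 ?powR_lt1.
pose D (u : G) := 1 - ((degree u)%:R - 1) * h - (degree u)%:R `^ gamma.
have D0 u : 0 <= D u.
  by rewrite subr_ge0 powR_chord_le // mE ler1n ler_nat degP.
have sumD0 : 0 <= \sum_u D u by apply: sumr_ge0.
have exc0 : 0 <= ((\sum_(u : G) degree u)%:R - 2 * m) * h.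
  by rewrite mulr_ge0 ?(ltW h0) // subr_ge0 mE -natrM ler_nat.
have gap := randic_gap gamma G2; rewrite /= -/m -/h in gap.
split; first by rewrite -subr_ge0 gap addr_ge0.
move=> eqR; move: gap; rewrite eqR subrr => /esym/eqP.
(* Equality makes both nonnegative parts of the gap vanish: the defects fix the individual degrees,
   and the excess, as [h > 0], fixes the degree sum. *)
rewrite paddr_eq0 // => /andP[/eqP sD /eqP exc].
apply: extremal_degrees_star_center => // [u|]; last first.
  move/eqP: exc; rewrite mulf_eq0 (gt_eqF h0) orbF subr_eq0 mE -natrM eqr_nat.
  by move/eqP.
have Du : D u = 0 by apply: (psumr_eq0P (fun i _ => D0 i) sD).
have [d1|d1] := eqVneq (degree u) 1%N; first by left.
have [dm|dm] := eqVneq (degree u) (#|G| - 1)%N; first by right.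
(* A degree strictly between [1] and [n - 1] would have a positive defect by strict convexity. *)
have : 0 < D u.
  rewrite subr_gt0 powR_chord_lt // mE ltr1n ltr_nat.
  by have := degP u; lia.
by rewrite Du ltxx.
Qed.
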